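(* The minimum number $d$ such that there exists a pair of non-congruent homometric polyominoes in $\mathbb{Z}^2$, each consisting of $d$ points, is $d=9$.
   Context: A polyomino in $\mathbb{Z}^2$ is a finite subset $A\subset\mathbb{Z}^2$ such that the set $A+[0,1]^2=\bigcup_{a\in A}(a+[0,1]^2)$ has connected interior. Two finite subsets $A,B\subset\mathbb{R}^n$ are homometric if $|A\cap(A+x)|=|B\cap(B+x)|$ for each $x\in\mathbb{R}^n$, where $|\cdot|$ denotes cardinality and $A+x=\{a+x:a\in A\}$. Two sets are non-congruent if there is no isometry of the space mapping one onto the other. *)

(* Defs.v *)
From HB Require Import structures.
From mathcomp Require Import all_boot all_order all_algebra.
From mathcomp Require Import finmap.
From mathcomp Require Import all_classical all_reals all_analysis.
Set Implicit Arguments.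
Unset Strict Implicit.
Unset Printing Implicit Defensive.
Import Order.TTheory GRing.Theory Num.Theory.
Import numFieldNormedType.Exports.
Local Open Scope classical_set_scope.
Local Open Scope ring_scope.

(* Points of R^n and Z^n are row vectors. The library norm on 'rV[R]_n is the
   sup norm, so the Euclidean distance is defined separately; both induce the
   same topology, so the library's interior and connectedness are the usual
   ones. *)
Definition euclidean_dist (R : realType) (n : nat) (x y : 'rV[R]_n) : R :=
  Num.sqrt (\sum_(i < n) (x 0 i - y 0 i) ^+ 2).

(* Surjectivity is automatic in R^n. *)
Definition isometry (R : realType) (n : nat) (f : 'rV[R]_n -> 'rV[R]_n) : Prop :=
  forall x y, euclidean_dist (f x) (f y) = euclidean_dist x y.

Definition congruent (R : realType) (n : nat) (A B : set 'rV[R]_n) : Prop :=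
  exists2 f : 'rV[R]_n -> 'rV[R]_n, isometry f & f @` A = B.

Definition translate (R : realType) (n : nat) (A : {fset 'rV[R]_n})
    (x : 'rV[R]_n) : {fset 'rV[R]_n} :=
  [fset (a + x)%R | a in A]%fset.

Definition homometric (R : realType) (n : nat) (A B : {fset 'rV[R]_n}) : Prop :=
  forall x : 'rV[R]_n,
    #|` (A `&` translate A x)%fset| = #|` (B `&` translate B x)%fset|.

Definition embed (R : realType) (n : nat) (A : {fset 'rV[int]_n}) :
    {fset 'rV[R]_n} :=
  [fset map_mx intr a | a in A]%fset.
Arguments embed R {n} A.

Definition unit_cube (R : realType) (n : nat) : set 'rV[R]_n :=
  [set u : 'rV[R]_n | forall i, 0 <= u 0 i <= 1].
Arguments unit_cube R n : clear implicits.

Definition polyomino (R : realType) (A : {fset 'rV[int]_2}) : Prop :=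
  connected
    (interior [set a + u | a in [set` embed R A] & u in unit_cube R 2]).

Definition noncongruent_homometric_pair (R : realType) (d : nat) : Prop :=
  exists A B : {fset 'rV[int]_2},
    [/\ polyomino R A /\ polyomino R B,
        #|` A| = d /\ #|` B| = d,
        homometric (embed R A) (embed R B)
      & ~ congruent [set` embed R A] [set` embed R B]].

(* Main.v *)
(* A grid-connected set of cells can be grown one adjacent cell at a time, so all
   polyominoes with at most 8 cells are enumerated, up to translation, by
   repeatedly adding a neighbour.  Homometric sets have the same multiset of
   differences, hence the same sum of any weight over their differences; for a
   suitable weight, equality of these sums already forces equality up to the
   symmetries of the square, which is checked by computation.

   A point lies in the interior of A + [0,1]^2 iff every cell containing it
   belongs to A.  Hence that interior is connected iff the grid graph on A is: two
   cells sharing a point are joined by at most two edge adjacencies through a third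
   cell containing that point, and conversely each point of the interior is joined by
   a segment to the center of a cell, and centers of adjacent cells to each other.

   Isometries preserve the number of points at distance 1; this separates the two
   homometric 9-cell polyominoes, of which only one has a cell with exactly three
   neighbours. *)
From Stdlib Require Import NArith.
Require Import Defs.
From HB Require Import structures.
From mathcomp Require Import all_boot all_order all_algebra.
From mathcomp Require Import finmap.
From mathcomp Require Import all_classical all_reals all_analysis.
From mathcomp Require Import zify lra.
Set Implicit Arguments.
Unset Strict Implicit.
Unset Printing Implicit Defensive.
Import Order.TTheory GRing.Theory Num.Theory.
Import numFieldNormedType.Exports.
Local Open Scope classical_set_scope.
Local Open Scope ring_scope.

(** * Enumeration of small polyominoes *)

Notation cell := (int * int)%type.

Definition directions : seq cell := [:: (1, 0); (0, 1); (-1, 0); (0, -1)].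

Definition neighbours (p : cell) : seq cell := map (+%R p) directions.

Definition le_cell (p q : cell) : bool :=
  if p.1 == q.1 then p.2 <= q.2 else p.1 <= q.1.

Fixpoint le_cells (s t : seq cell) : bool :=
  match s, t with
  | p :: s', q :: t' => if p == q then le_cells s' t' else le_cell p q
  | [::], _ => true
  | _, [::] => false
  end.

(** Moves the lexicographically least cell to the origin, so that translates get the same list; the
    default 0 is used only for the empty list. *)
Definition normalize (s : seq cell) : seq cell :=
  let t := sort le_cell s in map (+%R^~ (- head 0 t)) t.

(** Only adjacent repetitions are dropped; on a sorted list these are all of them. *)
Definition dedup (T : eqType) (s : seq T) : seq T :=
  foldr (fun x t => if t is y :: _ then if x == y then t else x :: t else [:: x])
    [::] s.

Definition grow (L : seq (seq cell)) : seq (seq cell) :=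
  dedup (sort le_cells
    [seq normalize (p :: s)
       | s <- L, p <- [seq p <- flatten (map neighbours s) | p \notin s]]).

Definition grown (k : nat) := iter k grow [:: [:: 0]].

Definition quarter_turn (p : cell) : cell := (- p.2, p.1).

Definition swap (p : cell) : cell := (p.2, p.1).

Definition orientations (s : seq cell) : seq (seq cell) :=
  [seq iter k (map quarter_turn) t | t <- [:: s; map swap s], k <- iota 0 4].

Definition canonical (s : seq cell) : seq cell :=
  head [::] (sort le_cells (map normalize (orientations s))).

Definition differences (s : seq cell) : seq cell := [seq p - q | p <- s, q <- s].

(* The argument allows any weight; with this one, as found by experiment,
   noncongruent polyominoes with at most 8 cells have distinct keys. *)
Definition weight (d : cell) : N :=
  let a := N.of_nat (absz d.1) in
  let b := N.of_nat (absz d.2) in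
  let c := N.of_nat (absz (d.1 + d.2)) in
  N.pow (a + 16 * b + 64 * c)%num 3%num.

Definition key (s : seq cell) : N :=
  foldr N.add 0%num (map weight (differences s)).

Definition entry s := (key s, canonical s).

(* This relation is transitive, so comparing adjacent entries of a list sorted by
   key compares all pairs. *)
Definition consistent (x y : N * seq cell) : bool :=
  if N.eqb x.1 y.1 then x.2 == y.2 else N.ltb x.1 y.1.

Definition key_determines_canonical k := sorted consistent
    (sort (fun x y => N.leb x.1 y.1) (map entry (grown k))).

Lemma mem_dedup (T : eqType) (s : seq T) : dedup s =i s.
Proof.
elim: s => //= x s IHs y; rewrite -/(dedup s) inE -IHs.
case: (dedup s) => [|z t]; first by rewrite !inE ?orbF.
by case: ifP => [/eqP ->|_]; rewrite !inE ?orbA ?orbb.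
Qed.

Lemma perm_normalize (s : seq cell) :
  exists t, perm_eq (normalize s) (map (+%R^~ t) s).
Proof. by exists (- head 0 (sort le_cell s)); rewrite perm_map // perm_sort. Qed.

(** Connectedness in terms of cuts rather than paths: an edge crosses each splitting of [s] into two
    nonempty parts. Enumeration and topology both apply it to a suitable cut. *)
Definition grid_connected (s : seq cell) : Prop :=
  forall P : pred cell, has P s -> has (predC P) s ->
  exists p q, [/\ p \in s, q \in s, P p, ~~ P q & q \in neighbours p].

Lemma cellB (x y x' y' : int) : (x, y) - (x', y') = (x - x', y - y') :> cell.
Proof. by []. Qed.

Lemma mem_neighbours (p q : cell) : (q \in neighbours p) = (q - p \in directions).
Proof. by rewrite -{1}(subrK p q) addrC mem_map //; exact: addrI. Qed.

Lemma neighboursC (p q : cell) : (q \in neighbours p) = (p \in neighbours q).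
Proof.
have sym x y : y \in neighbours x -> x \in neighbours y.
  by rewrite !mem_neighbours -[x - y]opprB !inE => /or4P[] /eqP ->.
by apply/idP/idP; apply: sym.
Qed.

(** Computable sufficient condition: each cell but the last has a neighbour further down the
    list. *)
Fixpoint linked (s : seq cell) : bool :=
  if s is p :: t then (nilp t || has [pred q | q \in t] (neighbours p)) && linked t else true.

(** A cut that splits the tail has an edge there by induction; one that is constant on the tail is
    crossed by the edge from the head to its neighbour in the tail. *)
Lemma linked_grid_connected (s : seq cell) : linked s -> grid_connected s.
Proof.
elim: s => // p t IHt /andP[/orP[/nilP -> _ P|/hasP[q pq /= qt] /IHt t_conn P]] /=.
  by rewrite !orbF => ->.
have [Pt|Pt] := boolP (has P t).
  have [Qt _ _|Qt _] := boolP (has (predC P) t).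
    have [x [y [xt yt Px Py xy]]] := t_conn P Pt Qt.
    by exists x, y; split=> //; rewrite inE ?xt ?yt orbT.
  rewrite orbF => nPp; exists q, p; rewrite neighboursC; split=> //.
  - by rewrite inE qt orbT.
  - exact: mem_head.
  by move/hasPn/(_ q qt): Qt; rewrite /= negbK.
rewrite orbF => Pp _; exists p, q; split=> //.
- exact: mem_head.
- by rewrite inE qt orbT.
exact: (hasPn Pt).
Qed.

Lemma eq_grid_connected (s t : seq cell) : s =i t -> grid_connected s -> grid_connected t.
Proof.
move=> st s_conn P; rewrite -!(eq_has_r st) => Ps Qs.
by have [p [q]] := s_conn P Ps Qs; rewrite !st; exists p, q.
Qed.

(** Induction on [k]: a piece with fewer cells than [s] defines a cut of [s], and the edge crossing
    it supplies a new cell of [s] adjacent to the piece. *)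
Lemma grown_sub (s : seq cell) (k : nat) :
    grid_connected s -> uniq s -> (k < size s)%N ->
  exists u t, [/\ u \in grown k, uniq u, size u = k.+1
                & {subset map (+%R^~ t) u <= s}].
Proof.
move=> s_conn s_uniq; elim: k => [|k IHk] ks.
  case: s ks {s_conn s_uniq} => // p s _; exists [:: 0], p.
  by split=> // q; rewrite inE add0r => /eqP ->; rewrite mem_head.
have [u [t [u_grown u_uniq u_size u_sub]]] := IHk (ltnW ks).
have inj_t : injective (+%R^~ t : cell -> cell) by apply: addIr.
have [||p [q [ps qs pu qu /mapP[e e_dir q_e]]]] := s_conn (mem (map (+%R^~ t) u)).
- case: u u_size u_sub {u_grown u_uniq} => // p u _ u_sub.
  by apply/hasP; exists (p + t); rewrite ?u_sub //= mem_head.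
- apply/negPn; rewrite -all_predC; apply/negP => /allP all_u.
  suff: (size s <= k.+1)%N by rewrite leqNgt ks.
  rewrite -u_size -(size_map (+%R^~ t) u); apply: uniq_leq_size => // p /all_u /=.
  by rewrite negbK.
have {pu} /mapP[p' p'u p_p'] := pu.
set q' := q - t; have q_q' : q = q' + t by rewrite subrK.
have q'u : q' \notin u by apply: contra qu => q'u; apply/mapP; exists q'.
have [t' norm_t'] := perm_normalize (q' :: u).
(* Normalizing moved the cells by [t'], so the shift back into [s] becomes [t - t']. *)
exists (normalize (q' :: u)), (t - t'); split.
- rewrite /grown iterS mem_dedup mem_sort; apply/allpairsPdep.
  exists u, q'; split=> //; rewrite mem_filter q'u; apply/flattenP.
  exists (neighbours p'); first by apply: map_f.
  by apply/mapP; exists e => //; rewrite /q' q_e p_p' addrAC addrK.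
- rewrite (perm_uniq norm_t') map_inj_uniq ?cons_uniq ?q'u //; exact: addIr.
- by rewrite (perm_size norm_t') size_map /= u_size.
move=> x /mapP[y]; rewrite (perm_mem norm_t') => /mapP[z zu ->] ->.
rewrite addrACA subrr addr0; move: zu; rewrite inE => /predU1P[->|zu].
  by rewrite -q_q'.
by apply: u_sub; apply: map_f.
Qed.

(** A piece of [s] with as many cells as [s] is all of it. *)
Lemma grown_complete (s : seq cell) :
    grid_connected s -> uniq s -> (0 < size s)%N ->
  exists u t, u \in grown (size s).-1 /\ perm_eq s (map (+%R^~ t) u).
Proof.
move=> s_conn s_uniq s_gt0.
have [|u [t [u_grown u_uniq u_size u_sub]]] := grown_sub (k := (size s).-1) s_conn s_uniq.
  by rewrite prednK.
exists u, t; split=> //; rewrite perm_sym.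
have tu_uniq : uniq (map (+%R^~ t) u) by rewrite map_inj_uniq //; apply: addIr.
have [|_ tu_s] := uniq_min_size tu_uniq u_sub; last exact: uniq_perm.
by rewrite size_map u_size prednK.
Qed.

Lemma perm_differences (s t : seq cell) :
  perm_eq s t -> perm_eq (differences s) (differences t).
Proof. by move=> st; apply: perm_allpairs. Qed.

Lemma differences_shift (s : seq cell) (t : cell) :
  differences (map (+%R^~ t) s) = differences s.
Proof.
rewrite /differences allpairs_mapl allpairs_mapr.
by apply: eq_allpairs => p q /=; rewrite opprD addrACA subrr addr0.
Qed.

(** Lets the sum in [key] be permuted as a big operator. *)
HB.instance Definition _ :=
  Monoid.isComLaw.Build N 0%num N.add N.add_assoc N.add_comm N.add_0_l.

Lemma perm_key (s t : seq cell) :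
  perm_eq (differences s) (differences t) -> key s = key t.
Proof.
by move=> /(perm_map weight) st; rewrite /key !foldrE; apply: perm_big.
Qed.

Lemma canonicalE (s : seq cell) :
  exists2 t, t \in orientations s & canonical s = normalize t.
Proof.
suff /mapP[t] : canonical s \in map normalize (orientations s) by exists t.
by rewrite /canonical -(mem_sort le_cells) -nth0 mem_nth // size_sort.
Qed.

Lemma consistent_trans : transitive consistent.
Proof.
move=> y x z; rewrite /consistent.
case: (N.eqb_spec x.1 y.1) => [->|_].
  by case: ifP => // _ /eqP -> .
move=> /N.ltb_lt xy; case: (N.eqb_spec y.1 z.1) => [<- _|_ /N.ltb_lt yz].
  by rewrite (N.eqb_neq _ _).2 ?(N.ltb_lt _ _).2 // => e; move: xy; rewrite e => /N.lt_irrefl.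
have xz := N.lt_trans _ _ _ xy yz.
by rewrite (N.eqb_neq _ _).2 ?(N.ltb_lt _ _).2 // => e; move: xz; rewrite e => /N.lt_irrefl.
Qed.

(** Both entries occur in the sorted list, and pairwise consistency forces equal canonical forms
    wherever the keys agree. *)
Lemma eq_canonical (k : nat) (s t : seq cell) :
    key_determines_canonical k -> s \in grown k -> t \in grown k -> key s = key t ->
  canonical s = canonical t.
Proof.
rewrite /key_determines_canonical (sorted_pairwise consistent_trans); set e := sort _ _.
move=> /(pairwiseP (entry [::])) e_ok s_k t_k st.
have e_mem u : u \in grown k -> entry u \in e.
  by move=> u_k; rewrite mem_sort map_f.
have := e_mem _ s_k; have := e_mem _ t_k.
move=> /(nthP (entry [::]))[j j_lt ej] /(nthP (entry [::]))[i i_lt ei].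
have consistent_eq a b : consistent a b -> a.1 = b.1 -> a.2 = b.2.
  by rewrite /consistent => + ab; rewrite ab N.eqb_refl => /eqP.
case: (ltngtP i j) => ij.
- have := e_ok _ _ i_lt j_lt ij; rewrite ei ej => /consistent_eq; exact.
- by have := e_ok _ _ j_lt i_lt ij; rewrite ei ej => /consistent_eq/(_ (esym st)).
- by move: ei; rewrite ij ej => -[].
Qed.

(** [grown k] holds polyominoes with [k + 1] cells, so the indices 0 to 7 stand for the sizes 1 to
    8. *)
Lemma key_determines_canonical_le8 : all key_determines_canonical (iota 0 8).
Proof. by vm_compute. Qed.

(** * Difference multisets and congruence *)

(** For given [p] and [x] the only possible [q] is [p - x], and it occurs at most once. *)
Lemma count_differences (V : zmodType) (s : seq V) (x : V) :
  uniq s -> count_mem x [seq p - q | p <- s, q <- s] = count (fun p => p - x \in s) s.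
Proof.
move=> s_uniq; rewrite count_flatten -map_comp.
rewrite -[RHS]sumn_count; congr sumn; apply: eq_map => p /=.
rewrite count_map -count_uniq_mem //; apply: eq_count => q /=.
by rewrite subr_eq addrC -subr_eq eq_sym.
Qed.

Lemma card_translate (R : realType) (n : nat) (X : {fset 'rV[R]_n}) (x : 'rV[R]_n) :
  #|` (X `&` translate X x)%fset| = count_mem x [seq p - q | p <- X, q <- X].
Proof.
rewrite count_differences ?fset_uniq // -size_filter; apply: perm_size.
apply: uniq_perm; rewrite ?fset_uniq ?filter_uniq ?fset_uniq // => y.
rewrite mem_filter inE andbC; congr (_ && _); apply/imfsetP/idP => /= [[z zX ->]|yX].
  by rewrite addrK.
by exists (y - x); rewrite ?subrK.
Qed.

Lemma ord2P (i : 'I_2) : i = 0 \/ i = 1.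
Proof. by case: i => [[|[|i]]] // lt_i; [left|right]; apply: val_inj. Qed.

Definition cell_of (a : 'rV[int]_2) : cell := (a 0 0, a 0 1).

Definition cells (A : {fset 'rV[int]_2}) : seq cell := map cell_of A.

Definition lattice_point (p : cell) : 'rV[int]_2 := \row_i (if i == 0 then p.1 else p.2).

Definition corner (R : realType) (p : cell) : 'rV[R]_2 := map_mx intr (lattice_point p).
Arguments corner R p : clear implicits.

Lemma lattice_pointK : cancel lattice_point cell_of.
Proof. by case=> x y; rewrite /cell_of !mxE. Qed.

Lemma cell_ofK : cancel cell_of lattice_point.
Proof.
by move=> a; apply/rowP => i; rewrite mxE; case: (ord2P i) => ->.
Qed.

Lemma corner0 (R : realType) (p : cell) : corner R p 0 0 = p.1%:~R.
Proof. by rewrite !mxE. Qed.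

Lemma corner1 (R : realType) (p : cell) : corner R p 0 1 = p.2%:~R.
Proof. by rewrite !mxE. Qed.

Lemma row2P (R : Type) (x y : 'rV[R]_2) : x 0 0 = y 0 0 -> x 0 1 = y 0 1 -> x = y.
Proof. by move=> xy0 xy1; apply/rowP => i; case: (ord2P i) => ->. Qed.

Lemma corner_inj (R : realType) : injective (corner R).
Proof.
move=> [x1 x2] [y1 y2] xy.
have := congr1 (fun v : 'rV_2 => v 0 0) xy; rewrite !corner0 => /intr_inj /= ->.
by have := congr1 (fun v : 'rV_2 => v 0 1) xy; rewrite !corner1 => /intr_inj /= ->.
Qed.

Lemma cornerB (R : realType) (p q : cell) : corner R (p - q) = corner R p - corner R q.
Proof. by apply: row2P; rewrite 2!mxE ?corner0 ?corner1 /= !mxE /= rmorphB. Qed.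

Lemma cornerD (R : realType) (p q : cell) : corner R (p + q) = corner R p + corner R q.
Proof. by apply: row2P; rewrite 2!mxE ?corner0 ?corner1 /= !mxE /= rmorphD. Qed.

Lemma cells_uniq (A : {fset 'rV[int]_2}) : uniq (cells A).
Proof. by rewrite map_inj_uniq ?fset_uniq //; exact: can_inj cell_ofK. Qed.

Lemma size_cells (A : {fset 'rV[int]_2}) : size (cells A) = #|` A|.
Proof. by rewrite size_map. Qed.

Lemma perm_embed (R : realType) (A : {fset 'rV[int]_2}) :
  perm_eq (embed R A) (map (corner R) (cells A)).
Proof.
apply: uniq_perm; rewrite ?fset_uniq //.
  by rewrite map_inj_uniq ?cells_uniq //; exact: corner_inj.
move=> x; rewrite -map_comp; apply/imfsetP/mapP => /= -[a aA ->]; exists a => //;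
  by rewrite /corner cell_ofK.
Qed.

(** The cardinalities compared are multiplicities of differences, so equality at every real [x] is
    equality of the difference multisets; injectivity of [corner] brings this back to integer
    cells. *)
Lemma homometricP (R : realType) (A B : {fset 'rV[int]_2}) :
  homometric (embed R A) (embed R B) <->
  perm_eq (differences (cells A)) (differences (cells B)).
Proof.
have E (X : {fset 'rV[int]_2}) x : #|` (embed R X `&` translate (embed R X) x)%fset| =
    count_mem x (map (corner R) (differences (cells X))).
  rewrite card_translate; move: (pred1 x); apply/permP.
  apply: perm_trans (perm_allpairs _ (perm_embed R X) (perm_embed R X)) _.
  rewrite allpairs_mapl allpairs_mapr map_allpairs.
  rewrite [X in perm_eq _ X](eq_allpairs (f2 := fun p q => corner R p - corner R q)) //.
  by move=> p q; exact: cornerB.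
split=> [AB|AB x]; last by rewrite !E; apply/permP; exact: perm_map.
apply: (perm_map_inj (@corner_inj R)); rewrite /perm_eq; apply/allP => x _ /=.
by rewrite -!E AB.
Qed.

(* The explicit inverse makes the relation symmetric.  [isometry] alone would now
   refer to the library's isometries of sesquilinear forms. *)
Definition rigid (R : realType) (n : nat) (X Y : set 'rV[R]_n) : Prop :=
  exists f g, [/\ cancel f g, cancel g f, Defs.isometry f & f @` X = Y].

Lemma rigid_congruent (R : realType) (n : nat) (X Y : set 'rV[R]_n) :
  rigid X Y -> congruent X Y.
Proof. by case=> f [g [_ _ f_iso fX]]; exists f. Qed.

Lemma rigid_refl (R : realType) (n : nat) (X : set 'rV[R]_n) : rigid X X.
Proof. by exists id, id; split=> //; rewrite image_id. Qed.

Lemma rigid_sym (R : realType) (n : nat) (X Y : set 'rV[R]_n) : rigid X Y -> rigid Y X.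
Proof.
case=> f [g [fK gK f_iso <-]]; exists g, f; split=> //.
  by move=> x y; rewrite -f_iso !gK.
by rewrite image_comp (_ : g \o f = id) ?image_id //; apply/funext.
Qed.

Lemma rigid_trans (R : realType) (n : nat) (X Y Z : set 'rV[R]_n) :
  rigid X Y -> rigid Y Z -> rigid X Z.
Proof.
case=> f [g [fK gK f_iso <-]] [f' [g' [fK' gK' f_iso' <-]]].
exists (f' \o f), (g \o g'); split; [exact: can_comp|exact: can_comp| |].
  by move=> x y /=; rewrite f_iso' f_iso.
by rewrite image_comp.
Qed.

Lemma euclidean_dist2 (R : realType) (x y : 'rV[R]_2) :
  euclidean_dist x y = Num.sqrt ((x 0 0 - y 0 0) ^+ 2 + (x 0 1 - y 0 1) ^+ 2).
Proof.
rewrite /euclidean_dist 2!big_ord_recl big_ord0 addr0.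
by rewrite (_ : lift ord0 ord0 = 1) //; apply: val_inj.
Qed.

Definition corners (R : realType) (s : seq cell) : set 'rV[R]_2 := [set` map (corner R) s].
Arguments corners R s : clear implicits.

Lemma perm_corners (R : realType) (s t : seq cell) :
  perm_eq s t -> corners R s = corners R t.
Proof.
move=> st; apply/seteqP.
by split=> x; rewrite /corners /= (perm_mem (perm_map (corner R) st)).
Qed.

Lemma corners_embed (R : realType) (A : {fset 'rV[int]_2}) :
  [set` embed R A] = corners R (cells A).
Proof. by apply/seteqP; split=> x; rewrite /corners /= (perm_mem (perm_embed R A)). Qed.

Lemma rigid_map (R : realType) (s : seq cell) (h : cell -> cell) (f g : 'rV[R]_2 -> 'rV[R]_2) :
  cancel f g -> cancel g f -> Defs.isometry f -> (forall p, f (corner R p) = corner R (h p)) ->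
  rigid (corners R s) (corners R (map h s)).
Proof.
move=> fK gK f_iso fh; exists f, g; split=> //; apply/seteqP; split=> x.
  by case=> y /= /mapP[p ps ->] <-; rewrite fh; do 2 apply: map_f.
rewrite /corners /= -map_comp => /mapP[p ps ->].
by exists (corner R p); [exact: map_f|exact: fh].
Qed.

Lemma rigid_shift (R : realType) (s : seq cell) (t : cell) :
  rigid (corners R s) (corners R (map (+%R^~ t) s)).
Proof.
apply: (@rigid_map R s _ (+%R^~ (corner R t)) (+%R^~ (- corner R t))).
- exact: addrK.
- by move=> x; rewrite subrK.
- by move=> x y; rewrite /euclidean_dist;
    under eq_bigr do rewrite !mxE opprD addrACA subrr addr0.
- by move=> p; rewrite cornerD.
Qed.

Lemma rigid_quarter_turn (R : realType) (s : seq cell) :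
  rigid (corners R s) (corners R (map quarter_turn s)).
Proof.
(* A right-angle turn, counterclockwise for [e = 1] and clockwise for [e = -1]; the two are
   inverse. *)
pose f (e : R) (x : 'rV[R]_2) : 'rV[R]_2 :=
  \row_i (if i == 0 then - (e * x 0 1) else e * x 0 0).
apply: (@rigid_map R s _ (f 1) (f (- 1))).
- by move=> x; apply: row2P; rewrite /f !mxE /= ?mxE /= ?mul1r ?mulN1r ?opprK.
- by move=> x; apply: row2P; rewrite /f !mxE /= ?mxE /= ?mul1r ?mulN1r ?opprK.
- move=> x y; rewrite !euclidean_dist2 !mxE /= !mul1r addrC; congr (Num.sqrt (_ + _)).
  by rewrite -opprD sqrrN.
- by move=> p; apply: row2P; rewrite mxE /= !mul1r ?corner0 ?corner1 //= rmorphN.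
Qed.

Lemma rigid_swap (R : realType) (s : seq cell) :
  rigid (corners R s) (corners R (map swap s)).
Proof.
pose f (x : 'rV[R]_2) : 'rV[R]_2 := \row_i (if i == 0 then x 0 1 else x 0 0).
have fK : cancel f f by move=> x; apply: row2P; rewrite /f !mxE /= ?mxE.
apply: (@rigid_map R s _ f f) => //.
- by move=> x y; rewrite !euclidean_dist2 !mxE /= addrC.
- by move=> p; apply: row2P; rewrite mxE /= ?corner0 ?corner1.
Qed.

Lemma rigid_turns (R : realType) (s : seq cell) (k : nat) :
  rigid (corners R s) (corners R (iter k (map quarter_turn) s)).
Proof.
elim: k => [|k IHk]; first exact: rigid_refl.
exact: rigid_trans IHk (rigid_quarter_turn _ _).
Qed.

(** The canonical form arises by at most one swap, some quarter turns and a translation, each a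
    rigid motion. *)
Lemma rigid_canonical (R : realType) (s : seq cell) :
  rigid (corners R s) (corners R (canonical s)).
Proof.
have [u /allpairsP[[t k] /= [ts _ ->]] ->] := canonicalE s.
have {ts} st : rigid (corners R s) (corners R t).
  move: ts; rewrite !inE => /orP[] /eqP ->; [exact: rigid_refl|exact: rigid_swap].
apply: (rigid_trans st); apply: (rigid_trans (rigid_turns R t k)).
have [r /perm_corners ->] := perm_normalize (iter k (map quarter_turn) t).
exact: rigid_shift.
Qed.

(** Equal difference multisets give the enumerated copies equal keys, hence equal canonical forms,
    and each set is rigidly equivalent to its canonical form. *)
Lemma homometric_congruent_le8 (R : realType) (A B : {fset 'rV[int]_2}) :
    grid_connected (cells A) -> grid_connected (cells B) ->
    (#|` A| <= 8)%N -> #|` A| = #|` B| ->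
    homometric (embed R A) (embed R B) ->
  congruent [set` embed R A] [set` embed R B].
Proof.
move=> A_conn B_conn A_le8 AB /homometricP AB_diff.
rewrite !corners_embed; apply: rigid_congruent.
(* The enumeration starts with one cell, so the empty sets are treated apart. *)
have [A0|A_gt0] := posnP #|` A|.
  move/eqP: (A0); rewrite AB; move/eqP: A0; rewrite -!size_cells.
  by move=> /nilP -> /nilP ->; exact: rigid_refl.
have [||u [t [u_grown Au]]] := grown_complete A_conn.
- exact: cells_uniq.
- by rewrite size_cells.
have [||v [t' [v_grown Bv]]] := grown_complete B_conn.
- exact: cells_uniq.
- by rewrite size_cells -AB.
have uv : canonical u = canonical v.
  apply: (@eq_canonical #|` A|.-1).
  - apply: (allP key_determines_canonical_le8).
    by rewrite mem_iota /= -(prednK A_gt0) in A_le8 *.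
  - by rewrite -size_cells.
  - by rewrite AB -size_cells.
  apply: perm_key; rewrite -(differences_shift u t) -(differences_shift v t').
  apply: perm_trans (perm_differences Bv); rewrite perm_sym.
  by apply: perm_trans (perm_differences Au); rewrite perm_sym.
have canon s r w :
    perm_eq s (map (+%R^~ r) w) -> rigid (corners R s) (corners R (canonical w)).
  move=> /(perm_corners R) ->; apply: rigid_trans (rigid_canonical R w).
  exact/rigid_sym/rigid_shift.
apply: rigid_trans (canon _ _ _ Au) _; rewrite uv.
exact/rigid_sym/(canon _ _ _ Bv).
Qed.

(** Distance 0 means equality, so an isometry is injective; it carries [X] bijectively onto [Y], and
    the points at distance [r] from [x] to those at distance [r] from its image. *)
Lemma congruent_count (R : realType) (n : nat) (X Y : seq 'rV[R]_n) (x : 'rV[R]_n) (r : R) :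
    uniq X -> uniq Y -> congruent [set` X] [set` Y] -> x \in X ->
  exists2 y, y \in Y &
    count (fun z => euclidean_dist y z == r) Y = count (fun z => euclidean_dist x z == r) X.
Proof.
move=> X_uniq Y_uniq [f f_iso fXY] xX.
have dist0 (u v : 'rV[R]_n) : euclidean_dist u v = 0 -> u = v.
  move=> /eqP; rewrite sqrtr_eq0 => uv; apply/rowP => i; apply/eqP.
  rewrite -subr_eq0 -sqrf_eq0; move: uv.
  rewrite le_eqVlt ltNge sumr_ge0 /= ?orbF => [|j _]; last exact: sqr_ge0.
  by rewrite psumr_eq0 => [/allP/(_ i)|j _]; [apply; rewrite mem_index_enum|exact: sqr_ge0].
have f_inj : injective f.
  move=> u v uv; apply: dist0; rewrite -f_iso uv /euclidean_dist big1 ?sqrtr0 //.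
  by move=> i _; rewrite subrr expr0n.
have XY : perm_eq (map f X) Y.
  apply: uniq_perm; rewrite ?map_inj_uniq // => y; apply/idP/idP => [/mapP[z zX ->]|yY].
    have : (f @` [set` X]) (f z) by exists z.
    by rewrite fXY.
  have : [set` Y] y by [].
  by rewrite -fXY => -[z zX <-]; apply: map_f.
exists (f x); first by rewrite -(perm_mem XY) map_f.
by rewrite -(permP XY) count_map; apply: eq_count => z /=; rewrite f_iso.
Qed.

(** At integer cells, squared distance 1 characterizes the grid neighbours, so the invariant is
    computed without real numbers. *)
Definition degree (s : seq cell) (p : cell) : nat :=
  count (fun q : cell => (p.1 - q.1) ^+ 2 + (p.2 - q.2) ^+ 2 == 1) s.

Lemma congruent_degree (R : realType) (s t : seq cell) (p : cell) :
    uniq s -> uniq t -> congruent (corners R s) (corners R t) -> p \in s ->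
  exists2 q, q \in t & degree t q = degree s p.
Proof.
move=> s_uniq t_uniq st ps.
have corner_map_uniq (u : seq cell) : uniq u -> uniq (map (corner R) u).
  by rewrite map_inj_uniq //; exact: corner_inj.
have degE u q :
    count (fun z => euclidean_dist (corner R q) z == 1) (map (corner R) u) = degree u q.
  rewrite count_map; apply: eq_count => v /=.
  rewrite euclidean_dist2 !corner0 !corner1 -!rmorphB -!rmorphXn -rmorphD /=.
  rewrite -[X in _ == X]sqrtr1 eqr_sqrt ?ler01 //.
    by rewrite -[RHS](eqr_int R).
  by rewrite ler0z addr_ge0 ?sqr_ge0.
have [|y /mapP[q qt ->]] :=
  congruent_count 1 (corner_map_uniq _ s_uniq) (corner_map_uniq _ t_uniq) st
    (x := corner R p).
  exact: map_f.
by rewrite !degE => dq; exists q.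
Qed.

(** * Interiors of unions of cells *)

Definition covers (R : realType) (m : int) (x : R) : bool := m%:~R <= x <= m%:~R + 1.

Definition touches (R : realType) (x : 'rV[R]_2) (p : cell) : bool :=
  covers p.1 (x 0 0) && covers p.2 (x 0 1).

(** The interior of the union of the closed cells of [s], described without topology;
    [interior_touches] justifies this. *)
Definition inner (R : realType) (s : seq cell) : set 'rV[R]_2 :=
  [set x | forall p, touches x p -> p \in s].
Arguments inner R s : clear implicits.

Lemma intr_lt1 (R : realType) (m k : int) : m%:~R < k%:~R + 1 :> R -> m <= k.
Proof. by rewrite -[1]/(1%:~R) -intrD ltr_int ltzD1. Qed.

Lemma covers_floor (R : realType) (x : R) : covers (Num.floor x) x.
Proof. by have /andP[? ?] := floor_itv x; rewrite /covers; lra. Qed.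

Lemma covers_strict (R : realType) (m k : int) (x : R) :
  m%:~R < x < m%:~R + 1 -> covers k x -> k = m.
Proof.
move=> /andP[? ?] /andP[? ?].
have ? : k <= m by apply: (@intr_lt1 R); lra.
have ? : m <= k by apply: (@intr_lt1 R); lra.
by lia.
Qed.

(** At an integer, radius 1 leaves only the two intervals meeting there; elsewhere the distance to
    the nearer end of the interval around [x] works. *)
Lemma covers_near (R : realType) (x : R) :
  exists2 e : R, 0 < e &
    forall y m, `|x - y| < e -> covers m y -> covers m x.
Proof.
have /andP[] := floor_itv x; rewrite intrD; set f := Num.floor x => fx xf.
have [xf0|xf0] := eqVneq x f%:~R.
  exists 1 => // y m; rewrite xf0 ltr_distlC => /andP[? ?] /andP[? ?].
  have mf : m <= f by apply: (@intr_lt1 R); lra.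
  have fm : f <= m + 1 by apply: (@intr_lt1 R); rewrite intrD; lra.
  by rewrite /covers -[1]/(1%:~R) -intrD !ler_int mf.
have {}fx : f%:~R < x by rewrite lt_neqAle eq_sym xf0.
exists (Num.min (x - f%:~R) (f%:~R + 1 - x)).
  by rewrite lt_min !subr_gt0 fx.
move=> y m; rewrite lt_min !ltr_distlC => /andP[/andP[? ?] /andP[? ?]] my.
have -> : m = f by apply: covers_strict my; lra.
by rewrite /covers; lra.
Qed.

Definition center (R : realType) (p : cell) : 'rV[R]_2 := corner R p + const_mx (2^-1).
Arguments center R p : clear implicits.

Lemma centerE (R : realType) (p : cell) :
  (center R p 0 0 = p.1%:~R + 2^-1) * (center R p 0 1 = p.2%:~R + 2^-1).
Proof. by split; rewrite !mxE. Qed.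

Lemma segment_strict (R : realType) (m : int) (x t : R) :
  covers m x -> 0 < t <= 1 -> m%:~R < x + t * (m%:~R + 2^-1 - x) < m%:~R + 1.
Proof. by move=> /andP[? ?] /andP[? ?]; apply/andP; split; nra. Qed.

(** A step from a point of a closed cell toward its center lands in the open cell, which no other
    closed cell meets. *)
Lemma segment_touches (R : realType) (x : 'rV[R]_2) (p q : cell) (t : R) :
  touches x p -> 0 < t <= 1 -> touches (x + t *: (center R p - x)) q -> q = p.
Proof.
case: p q => p1 p2 [q1 q2] /andP[/= xp1 xp2] t01 /andP[].
rewrite !mxE /= => xq1 xq2.
congr (_, _); first exact: covers_strict (segment_strict xp1 t01) xq1.
exact: covers_strict (segment_strict xp2 t01) xq2.
Qed.

Lemma touches_center (R : realType) (p q : cell) : touches (center R p) q = (q == p).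
Proof.
apply/idP/eqP => [|->].
  move=> /andP[]; rewrite !centerE; case: p q => [p1 p2] [q1 q2] /= q1p q2p.
  by congr (_, _); [apply: covers_strict q1p|apply: covers_strict q2p]; lra.
by rewrite /touches !centerE /covers; lra.
Qed.

Lemma exists_touches (R : realType) (x : 'rV[R]_2) : exists p, touches x p.
Proof. by exists (Num.floor (x 0 0), Num.floor (x 0 1)); rewrite /touches !covers_floor. Qed.

Lemma ball_row2 (R : realType) (x y : 'rV[R]_2) (e : R) :
  ball x e y <-> [/\ 0 < e, `|x 0 0 - y 0 0| < e & `|x 0 1 - y 0 1| < e].
Proof.
split=> [[e_gt0 xy]|[e_gt0 xy0 xy1]]; first by split=> //; apply: xy.
by split=> // i j; rewrite (ord1 i); case: (ord2P j) => ->.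
Qed.

(** If [x] is interior and lies in the cell [p], a point slightly nearer the center of [p] is still
    in the union but in no cell except [p], so [p] is in [s]. Conversely, points near [x] lie only
    in cells that contain [x]. *)
Lemma interior_touches (R : realType) (s : seq cell) :
  interior [set x | has (touches x) s] = inner R s.
Proof.
apply/seteqP; split=> x.
  move=> /nbhs_ballP[e /= e_gt0 xs] p xp.
  pose t : R := Num.min 1 (e / 2).
  have t01 : 0 < t <= 1 by rewrite /t lt_min ge_min lexx /= ltr01 divr_gt0.
  have te : t <= e / 2 by rewrite ge_min lexx orbT.
  have /xs/hasP[q qs xq] : ball x e (x + t *: (center R p - x)).
    apply/ball_row2; move: t01 xp => /andP[? ?] /andP[/andP[? ?] /andP[? ?]].
    by rewrite !mxE; split=> //; rewrite ltr_distlC; apply/andP; split; nra.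
  by rewrite -(segment_touches xp t01 xq).
move=> xs; have [e0 e0_gt0 near0] := covers_near (x 0 0).
have [e1 e1_gt0 near1] := covers_near (x 0 1).
apply/nbhs_ballP; exists (Num.min e0 e1) => /=; first by rewrite lt_min e0_gt0.
move=> y /ball_row2[_]; rewrite !lt_min => /andP[y0 _] /andP[_ y1].
have [p yp] := exists_touches y; apply/hasP; exists p => //; apply: xs.
by move: yp => /andP[yp0 yp1]; rewrite /touches (near0 _ _ y0 yp0) (near1 _ _ y1 yp1).
Qed.

Lemma polyominoE (R : realType) (A : {fset 'rV[int]_2}) :
  polyomino R A = connected (inner R (cells A)).
Proof.
rewrite /polyomino -interior_touches; congr (connected (interior _)).
apply/seteqP; split=> x.
  case=> a /= aA [u u01 <-]; rewrite (perm_mem (perm_embed R A)) in aA.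
  have /mapP[p ps ->] := aA; apply/hasP; exists p => //.
  have := u01 0; have := u01 1.
  by rewrite /touches /covers !mxE /= => /andP[? ?] /andP[? ?]; lra.
move=> /hasP[p ps /andP[/andP[x0p px0] /andP[x1p px1]]].
exists (corner R p); first by rewrite /= (perm_mem (perm_embed R A)) map_f.
exists (x - corner R p); last by rewrite addrC subrK.
by move=> i; case: (ord2P i) => ->; rewrite !mxE /=; lra.
Qed.

Lemma covers_neighbour (R : realType) (m k : int) (x : R) :
  covers m x -> covers k x -> k - m \in [:: 0; 1; -1].
Proof.
move=> /andP[? ?] /andP[? ?].
have ? : k <= m + 1 by apply: (@intr_lt1 R); rewrite intrD; lra.
have ? : m <= k + 1 by apply: (@intr_lt1 R); rewrite intrD; lra.
by rewrite !inE; lia.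
Qed.

(** Were no edge to cross the cut [P], the inner sets of its two sides would split the inner set of
    [s] into disjoint nonempty open parts. *)
Lemma inner_connected_grid (R : realType) (s : seq cell) :
  connected (inner R s) -> grid_connected s.
Proof.
move=> s_conn P /hasP[p0 p0s Pp0] /hasP[q0 q0s /= Qq0]; apply: contrapT => no_edge.
have edge p q : p \in s -> q \in s -> q = p \/ q \in neighbours p -> P p = P q.
  move=> ps qs [->//|pq]; apply/idP/idP => [Pp|Pq]; apply: contrapT => /negP nP;
    apply: no_edge; [by exists p, q|exists q, p; split=> //].
  by rewrite neighboursC.
have same x p q : inner R s x -> touches x p -> touches x q -> P p = P q.
  case: p q => [p1 p2] [q1 q2] xs xp xq.
  case/andP: (xp) (xq) => /= xp1 xp2 /andP[/= xq1 xq2].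
  (* The cell in the column of [q] and the row of [p] also contains [x], and it equals or adjoins
     each of them. *)
  have rs : (q1, p2) \in s by apply: xs; apply/andP.
  rewrite (edge _ (q1, p2)) //.
  - apply: edge => //; [exact: xs|rewrite mem_neighbours].
    rewrite cellB subrr.
    have := covers_neighbour xp2 xq2; rewrite 3!inE subr_eq0.
    by move=> /or3P[] /eqP ->; [left|right|right].
  - exact: xs.
  rewrite mem_neighbours cellB subrr.
  have := covers_neighbour xp1 xq1; rewrite 3!inE subr_eq0.
  by move=> /or3P[] /eqP ->; [left|right|right].
have inner_center p (t : seq cell) : p \in t -> inner R t (center R p).
  by move=> pt q; rewrite touches_center => /eqP ->.
have inner_sub (Q : pred cell) : inner R (seq.filter Q s) `<=` inner R s.
  by move=> x xs p /xs; rewrite mem_filter => /andP[].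
have : inner R (seq.filter P s) = inner R s.
  apply: s_conn.
  - by exists (center R p0); apply: inner_center; rewrite mem_filter Pp0.
  - exists (inner R (seq.filter P s)); last by rewrite setIidr //; exact: inner_sub.
    by rewrite -interior_touches; exact: open_interior.
  (* Relative closedness: within the inner set of [s], this side is the complement of the other,
     which is open. *)
  exists (~` inner R (seq.filter (predC P) s)).
    by apply: open_closedC; rewrite -interior_touches; exact: open_interior.
  apply/seteqP; split=> x.
    move=> xP; split; first exact: inner_sub xP.
    move=> xQ; have [p xp] := exists_touches x.
    by have := xP p xp; have := xQ p xp; rewrite !mem_filter /= => /andP[/negPf ->].
  move=> [xs xQ] p xp; rewrite mem_filter (xs _ xp) andbT; apply: contrapT => /negP nPp.
  by apply: xQ => q xq; rewrite mem_filter /= -(same x p q) ?nPp ?xs.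
move=> eq_s; have := inner_center q0 s q0s; rewrite -eq_s => /(_ q0).
by rewrite touches_center eqxx mem_filter (negPf Qq0) => /(_ isT).
Qed.

Lemma connected_component_segment (R : realType) (S : set 'rV[R]_2) (x y : 'rV[R]_2) :
  (forall t : R, 0 <= t <= 1 -> S (x + t *: (y - x))) -> connected_component S x y.
Proof.
move=> S_seg; pose f (t : R) := x + t *: (y - x).
apply: (@connected_component_max _ _ (f @` `[0, 1])).
- by exists 0; rewrite /= ?in_itv /= ?lexx ?ler01 // /f scale0r addr0.
- by move=> z [t]; rewrite /= in_itv /= => t01 <-; exact: S_seg.
- apply: connected_continuous_connected; first exact: segment_connected.
  apply: continuous_subspaceT => t; apply: cvgD; first exact: cvg_cst.
  by apply: cvgZr_tmp; exact: cvg_id.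
by exists 1; rewrite /= ?in_itv /= ?lexx ?ler01 // /f scale1r addrC subrK.
Qed.

Lemma covers_between (R : realType) (m e k : int) (t : R) :
    e \in [:: 0; 1; -1] -> 0 <= t <= 1 -> covers k (m%:~R + 2^-1 + t * e%:~R) ->
  k = m \/ k = e + m.
Proof.
move=> e01 /andP[? ?] /andP[]; rewrite !inE in e01.
case/or3P: e01 => /eqP -> kt tk.
- have ? : k <= m by apply: (@intr_lt1 R); lra.
  have ? : m <= k by apply: (@intr_lt1 R); lra.
  by lia.
- have ? : k <= m + 1 by apply: (@intr_lt1 R); rewrite intrD; lra.
  have ? : m <= k by apply: (@intr_lt1 R); lra.
  by lia.
have ? : k <= m by apply: (@intr_lt1 R); lra.
have ? : m <= k + 1 by apply: (@intr_lt1 R); rewrite intrD; lra.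
by lia.
Qed.

(** The segment between adjacent centers leaves the two open cells only at the midpoint of their
    common side, so it meets no third cell. *)
Lemma center_neighbour_touches (R : realType) (p q r : cell) (t : R) :
  q \in neighbours p -> 0 <= t <= 1 ->
  touches (center R p + t *: (center R q - center R p)) r -> r = p \/ r = q.
Proof.
rewrite mem_neighbours -{2 3}(subrK p q); move: (q - p) => [e1 e2] e_dir t01.
case: p r => p1 p2 [r1 r2]; rewrite /touches !mxE /= !intrD.
have addrKK (a b c : R) : a + b + c - (b + c) = a by rewrite -(addrA a) addrK.
rewrite !addrKK => /andP[/covers_between r1e /covers_between r2e].
have -> : (e1, e2) + (p1, p2) = (e1 + p1, e2 + p2) :> cell by [].
move: e_dir r1e r2e; rewrite !inE => /or4P[] /eqP[-> ->] /(_ isT t01) r1e /(_ isT t01);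
  case: r1e => -> [] ->; rewrite ?add0r; by [left|right].
Qed.

(** The component of one center contains every center, since otherwise an edge would join a center
    inside it to one outside; each point is then joined to the center of its cell. *)
Lemma grid_inner_connected (R : realType) (s : seq cell) :
  grid_connected s -> connected (inner R s).
Proof.
move=> s_conn; case: s s_conn => [|p0 s'] s_conn.
  rewrite (_ : inner R [::] = set0); first exact: connected0.
  by rewrite -subset0 => x xs; have [p /xs] := exists_touches x.
set s := p0 :: s' in s_conn *.
pose C := connected_component (inner R s) (center R p0).
have Ctrans x y : C x -> connected_component (inner R s) x y -> C y.
  by move=> Cx; apply: connected_component_trans.
have centers p : p \in s -> C (center R p).
  move=> ps; apply: contrapT => nCp.
  have [|| q [r [qs rs /asboolP Cq /asboolPn nCr qr]]] :=
    s_conn (fun q => `[< C (center R q) >]).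
  - apply/hasP; exists p0; first exact: mem_head.
    apply/asboolP/connected_component_refl => q.
    by rewrite touches_center => /eqP ->; exact: mem_head.
  - by apply/hasP; exists p => //; apply/asboolPn.
  apply: nCr; apply: Ctrans Cq _; apply: connected_component_segment => t t01 u.
  by move=> /(center_neighbour_touches qr t01)[] ->.
suff -> : inner R s = C by exact: component_connected.
apply/seteqP; split; last exact: connected_component_sub.
move=> x xs; have [p xp] := exists_touches x.
apply: Ctrans (centers p (xs _ xp)) _; apply: connected_component_sym.
apply: connected_component_segment => t /andP[t_ge0 t_le1].
(* At [t = 0] the point may touch several cells, all in [s] by assumption; later points touch [p]
   only. *)
have [->|t_neq0] := eqVneq t 0; first by rewrite scale0r addr0.
by move=> q /(segment_touches xp) -> //; [exact: xs|rewrite lt_def t_neq0 t_ge0].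
Qed.

(** * The pair of 9-cell polyominoes *)

(* ..##.    ##.##
   #####    ####.
   #..#.    .#...  *)
Definition ninomino1 : seq cell :=
  [:: (2, 1); (2, -2); (1, -2); (1, -1); (1, 2); (1, 1); (1, 0); (0, 1); (0, 0)].

Definition ninomino2 : seq cell :=
  [:: (2, 1); (0, 4); (0, 3); (1, 3); (1, 2); (1, 1); (1, 0); (0, 1); (0, 0)].

Definition fset_of_cells (s : seq cell) : {fset 'rV[int]_2} :=
  [fset lattice_point p | p in s]%fset.

Lemma perm_fset_of_cells (s : seq cell) : uniq s -> perm_eq (cells (fset_of_cells s)) s.
Proof.
move=> s_uniq; apply: uniq_perm => //; first exact: cells_uniq.
move=> p; apply/mapP/idP => [[a /imfsetP[q /= qs ->] ->]|ps].
  by rewrite lattice_pointK.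
exists (lattice_point p); last by rewrite lattice_pointK.
by apply/imfsetP; exists p.
Qed.

Lemma polyomino_fset_of_cells (R : realType) (s : seq cell) :
  uniq s -> linked s -> polyomino R (fset_of_cells s).
Proof.
move=> s_uniq s_linked; rewrite polyominoE; apply: grid_inner_connected.
apply: eq_grid_connected (linked_grid_connected s_linked) => p.
by rewrite (perm_mem (perm_fset_of_cells s_uniq)).
Qed.

Lemma card_fset_of_cells (s : seq cell) : uniq s -> #|` fset_of_cells s| = size s.
Proof. by move=> s_uniq; rewrite -size_cells (perm_size (perm_fset_of_cells s_uniq)). Qed.

Lemma ninomino_pair (R : realType) : noncongruent_homometric_pair R 9.
Proof.
have uniq1 : uniq ninomino1 by [].
have uniq2 : uniq ninomino2 by [].
exists (fset_of_cells ninomino1), (fset_of_cells ninomino2); split.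
- by split; apply: polyomino_fset_of_cells.
- by rewrite !card_fset_of_cells.
- apply/homometricP; apply: perm_trans (perm_differences (perm_fset_of_cells uniq1)) _.
  rewrite perm_sym; apply: perm_trans (perm_differences (perm_fset_of_cells uniq2)) _.
  by vm_compute.
rewrite !corners_embed (perm_corners R (perm_fset_of_cells uniq1)).
rewrite (perm_corners R (perm_fset_of_cells uniq2)) => /(congruent_degree uniq1 uniq2).
(* The cell (1, 0) of [ninomino1] has exactly three neighbours, a degree that does not occur in
   [ninomino2]. *)
move=> /(_ (1, 0) isT)[q q2 deg_q].
have /allP/(_ q q2) : all (fun p => degree ninomino2 p != degree ninomino1 (1, 0)) ninomino2.
  by vm_compute.
by rewrite deg_q eqxx.
Qed.

Theorem theorem1p4 (R : realType) :
  noncongruent_homometric_pair R 9 /\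
  (forall d : nat, noncongruent_homometric_pair R d -> (9 <= d)%N).
Proof.
split=> [|d [A [B [[A_poly B_poly] [Ad Bd] AB not_congr]]]]; first exact: ninomino_pair.
rewrite leqNgt; apply/negP => d_lt9; apply: not_congr.
have grid X : polyomino R X -> grid_connected (cells X).
  by rewrite polyominoE; exact: inner_connected_grid.
by apply: homometric_congruent_le8; rewrite ?Ad ?Bd //; exact: grid.
Qed.
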